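(* In the setting and under the standing assumptions given in the context, let $H=V-G$, $\mathcal C=\{x\in\mathbb R_+^2:H(x)>0\}$ and $\mathcal D=\{x\in\mathbb R_+^2:H(x)=0\}$. Assume that $V$ is continuous, that for every $x_1\ge0$ the map $x_2\mapsto H(x_1,x_2)$ is nonincreasing on $[0,\infty)$, and that for every $x_1\ge0$ the section $\{x_2\ge0:(x_1,x_2)\in\mathcal D\}$ is nonempty. Then there exists a lower semicontinuous function $b:[0,\infty)\to[0,\infty]$ such that $$\mathcal D=\{(x_1,x_2)\in\mathbb R_+^2:x_2\ge b(x_1)\}.$$ Equivalently, $$\mathcal C=\{(x_1,x_2)\in\mathbb R_+^2:0\le x_2<b(x_1)\}.$$
   Context: Setting. $\mathbb R_+^2=[0,\infty)^2$; $(\Omega,\mathcal F,\mathbb F,\mathbb P)$ is a filtered probability space satisfying the usual conditions, $W$ a two-dimensional Brownian motion. $X$ is the normally reflected diffusion $dX_t=\beta(X_t)dt+\sigma(X_t)dW_t+dL_t$, $X_0=x\in\mathbb R_+^2$, where each $L^i$ $(i=1,2)$ is continuous, adapted, nondecreasing, $L^i_0=0$, $\int_0^\infty\mathbf 1_{\{X^i_s>0\}}dL^i_s=0$. Set $a=\sigma\sigma^\top$ and $\mathcal Lf=\beta\cdot\nabla f+\frac12\operatorname{Tr}(aD^2f)$. Let $\alpha>0$, $G(x)=x_1\vee\alpha x_2$. Standing assumptions. (A1) $\beta:\mathbb R_+^2\to\mathbb R^2$, $\sigma:\mathbb R_+^2\to\mathbb R^{2\times2}$ are continuous and locally Lipschitz,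 $|\beta(x)|+|\sigma(x)|\le K(1+|x|)$, $a$ is locally uniformly elliptic in $(0,\infty)^2$, and the reflected SDE has a unique strong solution for every $x\in\mathbb R_+^2$. (A2) $c:\mathbb R_+^2\to[0,\infty)$ is continuous with at most polynomial growth, $r>0$, and for every $x$, $\mathbb E_x[\int_0^\infty e^{-rs}c(X_s)ds]<\infty$ and $\mathbb E_x[\sup_{t\ge0}e^{-rt}G(X_t)]<\infty$. (A3) There are $\Psi\in C^2(\mathbb R_+^2)$, $K_\Psi,\lambda_\Psi>0$, $m\ge1$ with $1+|x|^m\le K_\Psi\Psi(x)$, $G(x)+c(x)\le K_\Psi\Psi(x)$, $\mathcal L\Psi\le\lambda_\Psi\Psi+K_\Psi$ on $(0,\infty)^2$, and $r>\lambda_\Psi$. Value. $V(x)=\sup_{\tau\in\mathcal T}\mathbb E_x[e^{-r\tau}G(X_\tau)-\int_0^\tau e^{-rs}c(X_s)ds]$, $\mathcal T$ being all $\mathbb F$-stopping times, with $e^{-r\tau}G(X_\tau)=0$ on $\{\tau=\infty\}$. Since $\tau=0$ is admissible, $V\ge G$, so $H\ge0$. *)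

(* Defs.v *)
From HB Require Import structures.
From mathcomp Require Import all_boot all_order all_algebra.
From mathcomp Require Import all_classical all_reals all_analysis.

Set Implicit Arguments.
Unset Strict Implicit.
Unset Printing Implicit Defensive.

Import Order.TTheory GRing.Theory Num.Theory.
Import numFieldNormedType.Exports.

Local Open Scope classical_set_scope.
Local Open Scope ring_scope.

(* Conventions.  Points of the plane are column vectors; x 0 0 and x 1 0 are
   the first and the second coordinate.  Time is a real number, and only the
   times t >= 0 are ever constrained.  Path properties hold almost surely. *)

Section plane.
Context {R : realType}.

Definition vec2 (x1 x2 : R) : 'cV[R]_2 :=
  \col_(i < 2) (if i == 0 then x1 else x2).

Definition quadrant : set 'cV[R]_2 := [set x | forall i, 0 <= x i 0].

Definition open_quadrant : set 'cV[R]_2 := [set x | forall i, 0 < x i 0].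

(* Euclidean norm of a vector, Frobenius norm of a matrix; the library norm
   of a matrix is the maximum norm. *)
Definition enorm (m n : nat) (A : 'M[R]_(m, n)) : R :=
  Num.sqrt (\sum_i \sum_j A i j ^+ 2).

Definition basis_vector (i : 'I_2) : 'cV[R]_2 := delta_mx i 0.

Definition gradient (f : 'cV[R]_2 -> R) (x : 'cV[R]_2) : 'cV[R]_2 :=
  \col_i 'D_(basis_vector i) f x.

Definition hessian (f : 'cV[R]_2 -> R) (x : 'cV[R]_2) : 'M[R]_2 :=
  \matrix_(i, j) 'D_(basis_vector j) ('D_(basis_vector i) f) x.

(* C^2 on the closed quadrant: C^2 in the interior, and the function and all
   its partial derivatives up to order 2 extend continuously to the
   boundary. *)
Definition C2_quadrant (f : 'cV[R]_2 -> R) : Prop :=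
  {within quadrant, continuous f} /\
  exists (g : 'I_2 -> 'cV[R]_2 -> R) (h : 'I_2 -> 'I_2 -> 'cV[R]_2 -> R),
  [/\ forall i, {within quadrant, continuous (g i)},
      forall i j, {within quadrant, continuous (h i j)},
      forall i x, open_quadrant x -> is_derive x (basis_vector i) f (g i x) &
      forall i j x, open_quadrant x ->
        is_derive x (basis_vector j) (g i) (h i j x)].

Definition diffusion_matrix (sigma : 'cV[R]_2 -> 'M[R]_2) (x : 'cV[R]_2) :
  'M[R]_2 := sigma x *m (sigma x)^T.

Definition generator (beta : 'cV[R]_2 -> 'cV[R]_2)
    (sigma : 'cV[R]_2 -> 'M[R]_2) (f : 'cV[R]_2 -> R) (x : 'cV[R]_2) : R :=
  \sum_i beta x i 0 * gradient f x i 0 +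
  2^-1 * \tr (diffusion_matrix sigma x *m hessian f x).

Definition gain (alpha : R) (x : 'cV[R]_2) : R :=
  Num.max (x 0 0) (alpha * x 1 0).

Definition linear_growth (beta : 'cV[R]_2 -> 'cV[R]_2)
    (sigma : 'cV[R]_2 -> 'M[R]_2) : Prop :=
  exists K : R, forall x, quadrant x ->
    enorm (beta x) + enorm (sigma x) <= K * (1 + enorm x).

Definition locally_elliptic (a : 'cV[R]_2 -> 'M[R]_2) : Prop :=
  forall K : set 'cV[R]_2, compact K -> K `<=` open_quadrant ->
  exists2 lambda : R, 0 < lambda & forall x (xi : 'cV[R]_2), K x ->
    lambda * enorm xi ^+ 2 <= (xi^T *m a x *m xi) 0 0.

Definition polynomial_growth (f : 'cV[R]_2 -> R) : Prop :=
  exists (K : R) (p : nat), forall x, quadrant x ->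
    `|f x| <= K * (1 + enorm x ^+ p).

Definition regular_coefficients (beta : 'cV[R]_2 -> 'cV[R]_2)
    (sigma : 'cV[R]_2 -> 'M[R]_2) : Prop :=
  [/\ {within quadrant, continuous beta} /\
      {within quadrant, continuous sigma},
      [locally [lipschitz beta x | x in quadrant]],
      [locally [lipschitz sigma x | x in quadrant]],
      linear_growth beta sigma &
      locally_elliptic (diffusion_matrix sigma)].

Definition lyapunov_condition (beta : 'cV[R]_2 -> 'cV[R]_2)
    (sigma : 'cV[R]_2 -> 'M[R]_2) (alpha r : R) (c : 'cV[R]_2 -> R) : Prop :=
  exists (Psi : 'cV[R]_2 -> R) (K lambda m : R),
  [/\ C2_quadrant Psi,
      [/\ 0 < K, 0 < lambda, 1 <= m & lambda < r],
      forall x, quadrant x -> 1 + enorm x `^ m <= K * Psi x,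
      forall x, quadrant x -> gain alpha x + c x <= K * Psi x &
      forall x, open_quadrant x ->
        generator beta sigma Psi x <= lambda * Psi x + K].

End plane.

Section stochastic_basis.
Context {R : realType} {d : measure_display} {Omega : measurableType d}.
Variables (P : probability Omega R) (F : R -> set (set Omega)).
Implicit Types X L W : R -> Omega -> 'cV[R]_2.

Record usual_conditions : Prop := UsualConditions {
  filtration_sigma_algebra : forall t : R, 0 <= t -> sigma_algebra setT (F t) ;
  filtration_measurable : forall t : R, 0 <= t -> F t `<=` measurable ;
  filtration_nondecreasing : forall s t : R, 0 <= s -> s <= t -> F s `<=` F t ;
  filtration_right_continuous : forall t : R, 0 <= t ->
    F t = \bigcap_(u in [set u | t < u]) F u ;
  filtration_complete : P.-negligible `<=` F 0 }.

Definition adapted (E : R -> set (set Omega)) X : Prop :=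
  forall t : R, 0 <= t -> forall i (B : set R), measurable B ->
    E t ((fun w => X t w i 0) @^-1` B).

Definition continuous_paths (T : topologicalType) (Y : R -> Omega -> T) : Prop :=
  \forall w \ae P, {within `[0, +oo[, continuous (Y ^~ w)}.

(* The last field says at once that W t - W s is independent of F s, and that
   it has law N(0, (t - s) I); the second argument of normal_prob is the
   standard deviation. *)
Record brownian_motion W : Prop := BrownianMotion {
  brownian_adapted : adapted F W ;
  brownian_continuous : continuous_paths W ;
  brownian_start : \forall w \ae P, W 0 w = 0 ;
  brownian_increments : forall s t : R, 0 <= s -> s < t ->
    forall (A : set Omega) (B0 B1 : set R),
    F s A -> measurable B0 -> measurable B1 ->
    P (A `&` [set w | B0 (W t w 0 0 - W s w 0 0)]
         `&` [set w | B1 (W t w 1 0 - W s w 1 0)]) =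
    (P A * normal_prob 0 (Num.sqrt (t - s)) B0
         * normal_prob 0 (Num.sqrt (t - s)) B1)%E }.

Definition brownian_filtration W (t : R) : set (set Omega) :=
  <<s [set A | exists (s : R) i (B : set R), [/\ 0 <= s, s <= t, measurable B &
                 A = (fun w => W s w i 0) @^-1` B]]
      `|` P.-negligible >>.

Definition cvg0_in_probability (Y : nat -> Omega -> \bar R) : Prop :=
  forall eps : R, 0 < eps ->
    P [set w | eps%:E < `|Y n w|]%E @[n --> \oo] --> 0%E.

(* The process sum_(i < simple_size) coef i 1_{]time i, time i.+1]}. *)
Record simple_process := SimpleProcess {
  simple_size : nat ;
  simple_time : nat -> R ;
  simple_coef : nat -> Omega -> R }.

Definition simple_predictable (S : simple_process) : Prop :=
  0 <= simple_time S 0%N /\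
  forall i, (i < simple_size S)%N ->
  [/\ simple_time S i <= simple_time S i.+1,
      exists M : R, forall w, `|simple_coef S i w| <= M &
      forall B : set R, measurable B ->
        F (simple_time S i) (simple_coef S i @^-1` B)].

Definition simple_value (S : simple_process) (t : R) (w : Omega) : R :=
  \sum_(i < simple_size S)
    simple_coef S i w * \1_`]simple_time S i, simple_time S i.+1] t.

Definition simple_integral (S : simple_process) (B : R -> Omega -> R)
    (t : R) (w : Omega) : R :=
  \sum_(i < simple_size S) simple_coef S i w *
    (B (Num.min (simple_time S i.+1) t) w - B (Num.min (simple_time S i) t) w).

(* I is the Ito integral of phi against the Brownian motion B: the continuous
   process which is the limit in probability of the integrals of simple
   processes that converge to phi in L^2([0, t]) in probability. *)
Definition ito_integral (phi B I : R -> Omega -> R) : Prop :=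
  continuous_paths I /\
  exists S : nat -> simple_process,
  [/\ forall n, simple_predictable (S n),
      forall t : R, 0 <= t -> cvg0_in_probability (fun n w =>
        (\int[lebesgue_measure]_(s in `[0%R, t])
           ((simple_value (S n) s w - phi s w) ^+ 2)%R%:E)%E) &
      forall t : R, 0 <= t -> cvg0_in_probability (fun n w =>
        (simple_integral (S n) B t w - I t w)%:E)].

(* The Lebesgue-Stieltjes measure of a path of L is that of its extension by 0
   to the negative times, which is a cumulative function of the library. *)
Definition grows_only_at_zero (Xi Li : R -> R) : Prop :=
  exists l : cumulative R R,
  [/\ forall t : R, 0 <= t -> l t = Li t,
      forall t : R, t < 0 -> l t = 0 &
      (\int[lebesgue_stieltjes_measure l]_(s in `[0%R, +oo[)
         (\1_[set u | 0 < Xi u] s)%:E = 0)%E].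

Record reflected_solution W (beta : 'cV[R]_2 -> 'cV[R]_2)
    (sigma : 'cV[R]_2 -> 'M[R]_2) (x : 'cV[R]_2) X L : Prop :=
  ReflectedSolution {
  state_adapted : adapted F X ;
  state_continuous : continuous_paths X ;
  state_start : \forall w \ae P, X 0 w = x ;
  state_quadrant : \forall w \ae P, forall t : R, 0 <= t -> quadrant (X t w) ;
  reflection_adapted : adapted F L ;
  reflection_continuous : continuous_paths L ;
  reflection_start : \forall w \ae P, L 0 w = 0 ;
  reflection_nondecreasing : \forall w \ae P, forall i (s t : R),
    0 <= s -> s <= t -> L s w i 0 <= L t w i 0 ;
  reflection_minimal : \forall w \ae P, forall i,
    grows_only_at_zero (fun t => X t w i 0) (fun t => L t w i 0) ;
  state_equation : exists I : 'I_2 -> 'I_2 -> R -> Omega -> R,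
    (forall i j, ito_integral (fun t w => sigma (X t w) i j)
                              (fun t w => W t w j 0) (I i j)) /\
    \forall w \ae P, forall t : R, 0 <= t -> forall i,
      X t w i 0 = x i 0
        + \int[lebesgue_measure]_(s in `[0, t]) (beta (X s w) i 0)
        + \sum_j I i j t w
        + L t w i 0 }.

Definition unique_strong_solution W (beta : 'cV[R]_2 -> 'cV[R]_2)
    (sigma : 'cV[R]_2 -> 'M[R]_2) (x : 'cV[R]_2) : Prop :=
  (exists X L, [/\ reflected_solution W beta sigma x X L,
     adapted (brownian_filtration W) X & adapted (brownian_filtration W) L]) /\
  (forall X L X' L', reflected_solution W beta sigma x X L ->
     reflected_solution W beta sigma x X' L' ->
     \forall w \ae P, forall t : R, 0 <= t ->
       X t w = X' t w /\ L t w = L' t w).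

Definition stopping_time (tau : Omega -> \bar R) : Prop :=
  (forall w, 0 <= tau w)%E /\
  forall t : R, 0 <= t -> F t [set w | tau w <= t%:E]%E.

(* The family X is indexed by the starting point: E_x is the expectation of a
   functional of X x under P. *)
Definition integrable_cost (alpha r : R) (c : 'cV[R]_2 -> R)
    (X : 'cV[R]_2 -> R -> Omega -> 'cV[R]_2) : Prop :=
  [/\ forall x, quadrant x -> 0 <= c x,
      {within quadrant, continuous c} /\ polynomial_growth c,
      0 < r,
      forall x, quadrant x ->
        (\int[P]_w \int[lebesgue_measure]_(s in `[0%R, +oo[)
           (expR (- (r * s)) * c (X x s w))%:E < +oo)%E &
      forall x, quadrant x ->
        (\int[P]_w ereal_sup [set (expR (- (r * t)) * gain alpha (X x t w))%:E
                                 | t in `[0%R, +oo[ ] < +oo)%E].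

Definition payoff (alpha r : R) (c : 'cV[R]_2 -> R) X
    (tau : Omega -> \bar R) (w : Omega) : \bar R :=
  ((if tau w is t%:E then (expR (- (r * t)) * gain alpha (X t w))%:E else 0)
   - \int[lebesgue_measure]_(s in [set s : R | (0 <= s)%R /\ s%:E <= tau w])
       (expR (- (r * s)) * c (X s w))%:E)%E.

Definition value (alpha r : R) (c : 'cV[R]_2 -> R)
    (X : 'cV[R]_2 -> R -> Omega -> 'cV[R]_2) (x : 'cV[R]_2) : \bar R :=
  ereal_sup [set (\int[P]_w payoff alpha r c (X x) tau w)%E
            | tau in stopping_time].

End stochastic_basis.

(* Main.v *)
(* Stopping at time 0 gives G <= V, so D is the complement of C = {G < V} in the
   quadrant, and C is relatively open since V and G are continuous.  As H is
   nonincreasing in x2, each vertical section of D is an up-set; hence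
   b x1 = inf {x2 | (x1, x2) in D} is attained, and b is lower semicontinuous
   because {b > a} is the horizontal section of C at height a. *)

Require Import Defs.
From HB Require Import structures.
From mathcomp Require Import all_boot all_order all_algebra.
From mathcomp Require Import all_classical all_reals all_analysis.
From mathcomp Require Import measurable_realfun.

Set Implicit Arguments.
Unset Strict Implicit.
Unset Printing Implicit Defensive.

Import Order.TTheory GRing.Theory Num.Theory.
Import numFieldNormedType.Exports.

Local Open Scope classical_set_scope.
Local Open Scope ring_scope.

Lemma quadrant_vec2 (R : realType) (x1 x2 : R) :
  quadrant (vec2 x1 x2) <-> 0 <= x1 /\ 0 <= x2.
Proof.
split=> [q | [x1_ge0 x2_ge0] i].
  by have := q 0; have := q 1; rewrite !mxE.
by rewrite mxE; case: ifP.
Qed.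

Lemma vec2_eta (R : realType) (x : 'cV[R]_2) : vec2 (x 0 0) (x 1 0) = x.
Proof.
apply/colP => i; rewrite mxE; case: ifPn => [/eqP -> //|].
by case: i => -[|[|//]] // i2 _; congr (x _ _); apply: val_inj.
Qed.

Lemma vec2_ball (R : realType) (x y u v e : R) :
  ball x e u -> ball y e v -> ball (vec2 x y) e (vec2 u v).
Proof.
(* A ball of matrices also carries the condition [0 < e], which follows from [|x - u| < e]. *)
move=> xu yv; split; first exact: le_lt_trans xu.
by move=> i j; rewrite !mxE; case: ifP.
Qed.

Lemma gain_continuous (R : realType) (alpha : R) : continuous (gain alpha).
Proof.
move=> x.
have mul_continuous : {for x, continuous (fun y : 'cV[R]_2 => alpha * y 1 0)}.
  exact: (continuous_comp (@coord_continuous _ _ _ 1 0 x) (@mulrl_continuous R alpha _)).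
exact: (continuous_max (@coord_continuous _ _ _ 0 0 x) mul_continuous).
Qed.

(** A real [q] strictly between [g x] and [f x] separates the two functions near [x]. With [g] the
    gain and [f] the value, which may be infinite, this yields the relative openness of [C]. *)
Lemma near_within_lt (R : realType) (T : topologicalType) (A : set T)
    (g : T -> R) (f : T -> \bar R) (x : T) :
  continuous g -> {within A, continuous f} -> A x -> ((g x)%:E < f x)%E ->
  \forall y \near within A (nbhs x), ((g y)%:E < f y)%E.
Proof.
move=> gc /subspace_continuousP fc Ax gfx.
have [q gq qf] : exists2 q : R, g x < q & (q%:E < f x)%E.
  move: (f x) gfx => [s| |//]; rewrite ?lte_fin => gs.
    by have [? ?] := midf_lt gs; exists ((g x + s) / 2); rewrite ?lte_fin.
  by exists (g x + 1); rewrite ?ltry // ltrDl.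
have near_g : \forall y \near within A (nbhs x), g y < q.
  exact: (cvg_within _ (cvgr_lt (g x) (gc x) q gq)).
have near_f : \forall y \near within A (nbhs x), (q%:E < f y)%E.
  exact: (fc x Ax _ (open_ereal_gt' qf)).
near=> y; apply: (@lt_trans _ _ q%:E); first by rewrite lte_fin; near: y.
by near: y.
Unshelve. all: by end_near. Qed.

(** The constant time 0 is admissible and pays the gain at [X x 0], which is almost surely the gain
    at [x]. *)
Lemma gain_le_value (R : realType) (d : measure_display)
    (Omega : measurableType d) (P : probability Omega R)
    (F : R -> set (set Omega)) (alpha r : R) (c : 'cV[R]_2 -> R)
    (X : 'cV[R]_2 -> R -> Omega -> 'cV[R]_2) (x : 'cV[R]_2) :
  usual_conditions P F -> adapted F (X x) -> (\forall w \ae P, X x 0 w = x) ->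
  ((gain alpha x)%:E <= value P F alpha r c X x)%E.
Proof.
move=> uF adX X0; apply: ereal_sup_ubound; exists (cst 0%E).
  split=> [//|t t_ge0]; have [F0 FC _] := filtration_sigma_algebra uF t_ge0.
  have := FC _ F0; rewrite setD0; congr (F t _).
  by apply/seteqP; split=> // w _ /=; rewrite lee_fin.
have -> : payoff alpha r c (X x) (cst 0%E) = fun w => (gain alpha (X x 0 w))%:E.
  (* The running cost is integrated over a subset of the singleton of 0, hence vanishes. *)
  apply/funext => w; rewrite /payoff /= (@integral_Sset1 _ _ _ 0).
    by rewrite mulr0 oppr0 expR0 mul1r sube0.
  by move=> s [s_ge0]; rewrite lee_fin => s_le0; apply/eqP; rewrite eq_le s_le0.
(* Since [X x 0 w = x] holds only almost surely, the integrand is replaced almost everywhere; the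
   measurability this requires comes from adaptedness at time 0. *)
have mX i : measurable_fun setT (fun w => X x 0 w i 0).
  move=> _ B mB; rewrite setTI.
  exact/(filtration_measurable uF (lexx 0))/adX.
rewrite (ae_eq_integral (cst (gain alpha x)%:E)) //.
- by rewrite integral_cst // [X in (_ * X)%E]probability_setT mule1.
- apply/measurable_EFinP; apply: measurable_maxr; first exact: mX.
  exact: measurable_funM.
- by apply: filterS X0 => w /= -> _.
Qed.

(** Relative openness of the complement of [D] serves twice: vertically, it makes the infimum of a
    section attained; horizontally, it makes the boundary lower semicontinuous. *)
Lemma closed_upward_section_boundary (R : realType) (D : set 'cV[R]_2) :
  D `<=` quadrant ->
  (forall x, quadrant x -> ~ D x ->
     \forall y \near within quadrant (nbhs x), ~ D y) ->
  (forall x1 y z : R, 0 <= y -> y <= z -> D (vec2 x1 y) -> D (vec2 x1 z)) ->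
  exists b : R -> \bar R,
  [/\ forall x1 : R, 0 <= x1 -> (0 <= b x1)%E,
      lower_semicontinuous (b : subspace `[0, +oo[ -> \bar R) &
      D = [set x | quadrant x /\ (b (x 0%R 0%R) <= (x 1%R 0%R)%:E)%E]].
Proof.
move=> Dq DC Dup.
(* An empty section gives [+oo]; this covers every [x1 < 0], as [D] lies in the quadrant. *)
pose b x1 : \bar R := ereal_inf [set x2%:E | x2 in [set x2 | D (vec2 x1 x2)]].
have b_le x1 x2 : D (vec2 x1 x2) -> (b x1 <= x2%:E)%E.
  by move=> Dx; apply: ereal_inf_lbound; exists x2.
have b_lt x1 x2 : (b x1 < x2%:E)%E -> D (vec2 x1 x2).
  move=> /ereal_inf_lt[_ [y Dy <-]]; rewrite lte_fin => /ltW yx.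
  by have [_ y_ge0] := iffLR (quadrant_vec2 _ _) (Dq _ Dy); exact: Dup yx Dy.
(* Balls of the maximum norm are products of intervals, so the two coordinates can be varied
   separately. *)
have nD_ball (x1 x2 : R) : 0 <= x1 -> 0 <= x2 -> ~ D (vec2 x1 x2) ->
    exists2 e : R, 0 < e & forall y1 y2 : R, 0 <= y1 -> 0 <= y2 ->
      ball x1 e y1 -> ball x2 e y2 -> ~ D (vec2 y1 y2).
  move=> x1_ge0 x2_ge0 nD.
  have q12 : quadrant (vec2 x1 x2) by exact/quadrant_vec2.
  have /nbhs_ballP[e e_gt0 eP] := DC _ q12 nD.
  exists e => // y1 y2 y1_ge0 y2_ge0 xy1 xy2.
  by apply: eP; [exact: vec2_ball | exact/quadrant_vec2].
(* The point at height [x2 + e / 2] is still outside [D], so by [b_lt] the infimum is at least that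
   height, strictly above [x2]. *)
have lt_b (x1 x2 : R) : 0 <= x1 -> 0 <= x2 -> ~ D (vec2 x1 x2) -> (x2%:E < b x1)%E.
  move=> x1_ge0 x2_ge0 /nD_ball[] // e e_gt0 eP.
  apply: (@lt_le_trans _ _ (x2 + e / 2)%:E).
    by rewrite lte_fin ltrDl divr_gt0.
  rewrite leNgt; apply/negP => /b_lt; apply: eP => //.
  - by rewrite addr_ge0 // ltW // divr_gt0.
  - exact: ballxx.
  - rewrite /ball /= opprD addNKr normrN gtr0_norm ?divr_gt0 //.
    by rewrite ltr_pdivrMr // ltr_pMr // ltr1n.
have b_ge0 x1 : (0 <= b x1)%E.
  apply: le_ereal_inf_tmp => _ [y Dy <-]; rewrite lee_fin.
  by case/quadrant_vec2: (Dq _ Dy).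
exists b; split=> //.
- move=> x a ab; exists [set y | (a%:E < b y)%E] => //.
  (* A negative level lies below [b] everywhere; only for [a >= 0] is the point at height [a] in the
     quadrant. *)
  have [a_lt0|a_ge0] := ltP a 0.
    apply: filterS filterT => y _ /=.
    by apply: lt_le_trans (b_ge0 y); rewrite lte_fin.
  (* In the subspace topology a point outside the half-line is isolated, so only [x] itself has to
     be checked there. *)
  case: (@nbhs_subspaceP R `[0, +oo[ x) => [|_ _ -> //].
  rewrite /= in_itv /= andbT => x_ge0.
  have [|e e_gt0 eP] := nD_ball x a x_ge0 a_ge0.
    by move=> /b_le; rewrite leNgt ab.
  apply/nbhs_ballP; exists e => // y xy; rewrite /= in_itv /= andbT => y_ge0.
  by apply: lt_b => //; apply: eP => //; exact: ballxx.
- apply/seteqP; split=> x; rewrite -(vec2_eta x).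
  + by move=> Dx; split; [exact: Dq | rewrite !mxE; exact: b_le].
  + move=> [/quadrant_vec2[x1_ge0 x2_ge0]]; rewrite !mxE /= => bx.
    by apply: contrapT => /(lt_b _ _ x1_ge0 x2_ge0); rewrite ltNge bx.
Qed.

Theorem theorem4p2 (R : realType) (d : measure_display)
    (Omega : measurableType d) (P : probability Omega R)
    (F : R -> set (set Omega)) (W : R -> Omega -> 'cV[R]_2)
    (beta : 'cV[R]_2 -> 'cV[R]_2) (sigma : 'cV[R]_2 -> 'M[R]_2)
    (alpha r : R) (c : 'cV[R]_2 -> R)
    (X L : 'cV[R]_2 -> R -> Omega -> 'cV[R]_2) :
  usual_conditions P F ->
  brownian_motion P F W ->
  0 < alpha ->
  regular_coefficients beta sigma ->
  (forall x, quadrant x -> unique_strong_solution P F W beta sigma x) ->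
  (forall x, quadrant x ->
     reflected_solution P F W beta sigma x (X x) (L x)) ->
  integrable_cost P alpha r c X ->
  lyapunov_condition beta sigma alpha r c ->
  let V := value P F alpha r c X in
  let H : 'cV[R]_2 -> \bar R := fun x => (V x - (gain alpha x)%:E)%E in
  let C := [set x : 'cV[R]_2 | quadrant x /\ (0 < H x)%E] in
  let D := [set x : 'cV[R]_2 | quadrant x /\ H x = 0%E] in
  {within quadrant, continuous V} ->
  (forall x1 y z : R, 0 <= x1 -> 0 <= y -> y <= z ->
     (H (vec2 x1 z) <= H (vec2 x1 y))%E) ->
  (forall x1 : R, 0 <= x1 -> exists2 x2 : R, 0 <= x2 & D (vec2 x1 x2)) ->
  exists b : R -> \bar R,
  [/\ forall x1 : R, 0 <= x1 -> (0 <= b x1)%E,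
      lower_semicontinuous (b : subspace `[0, +oo[ -> \bar R),
      D = [set x : 'cV[R]_2 | quadrant x /\ (b (x 0%R 0%R) <= (x 1%R 0%R)%:E)%E] &
      C = [set x : 'cV[R]_2 | quadrant x /\ ((x 1%R 0%R)%:E < b (x 0%R 0%R))%E]].
Proof.
move=> uF _ _ _ _ sol _ _ V H C D Vc Hmono _.
have gV x : quadrant x -> ((gain alpha x)%:E <= V x)%E.
  move=> qx; have Xx := sol x qx.
  by apply: gain_le_value => //; [exact: state_adapted Xx | exact: state_start Xx].
have H_ge0 x : quadrant x -> (0 <= H x)%E by move=> qx; rewrite sube_ge0 // gV.
have H_gt0 x : (0 < H x)%E = ((gain alpha x)%:E < V x)%E by rewrite sube_gt0.
(* As [H] is nonnegative, [C] and [D] partition the quadrant. *)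
have CnD x : quadrant x -> (0 < H x)%E <-> ~ D x.
  move=> qx; rewrite lt0e H_ge0 // andbT; split=> [/eqP H0 [_ //]|nD].
  by apply/eqP => H0; apply: nD.
have [|x qx nDx|x1 y z y_ge0 yz [/quadrant_vec2[x1_ge0 _] Hy]|
    b [b_ge0 b_lsc Db]] := @closed_upward_section_boundary R D.
- by move=> x [].
- have := near_within_lt (@gain_continuous R alpha) Vc qx.
  rewrite -H_gt0 => /(_ (iffRL (CnD x qx) nDx)).
  by apply: filterS => y; rewrite -H_gt0 => Hy [_ Hy0]; rewrite Hy0 ltxx in Hy.
- have qz : quadrant (vec2 x1 z).
    by apply/quadrant_vec2; split=> //; exact: le_trans yz.
  (* Monotonicity squeezes [H] at height [z] between 0 and its value 0 at height [y]. *)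
  split=> //; apply/eqP; rewrite eq_le H_ge0 // andbT -Hy.
  exact: Hmono.
exists b; split=> //; apply/seteqP; split=> x [qx] => [/CnD|bx].
  move=> /(_ qx) nD; split=> //; rewrite ltNge; apply/negP => bx.
  by apply: nD; rewrite Db.
by split=> //; apply/CnD => //; rewrite Db => -[_]; rewrite leNgt bx.
Qed.
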